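(* Let $G_0,G_1,G_2,\dots$ be nonempty graphs. Then $(G_n)_{n\in\mathbb N}$ is a Cauchy sequence with respect to the asymptotic spectrum distance if and only if the sequence $(G_n^{\boxtimes n})_{n\in\mathbb N}$ is approximately geometric with respect to the asymptotic cohomomorphism preorder.
   Context: Graphs are finite, simple and undirected; nonempty means having at least one vertex. The semiring of graphs $\mathcal G$ consists of isomorphism classes of graphs with disjoint union $\sqcup$ as addition, strong product $\boxtimes$ as multiplication ($V(G\boxtimes H)=V(G)\times V(H)$, distinct vertices $(g,h),(g',h')$ being adjacent iff $g,g'$ are equal or adjacent and $h,h'$ are equal or adjacent), and the cohomomorphism preorder: $G\le H$ iff there is a graph homomorphism $\overline G\to\overline H$ between complements. Natural numbers $r$ correspond to the edgeless graphs $\overline{K_r}$; $G^{\boxtimes m}$ is the $m$-fold strong power, $G^{\boxtimes0}=K_1$. $\mathbb N$ includes $0$; a sublinear sequence is a sequence $(k_n)_{n\in\mathbb N}$ in $\mathbb N$ with $k_n/n\to0$. The asymptotic cohomomorphism preorder $\lesssim$ on $\mathcal G$: $G\lesssim H$ iff there is a sublinear $(k_n)$ with $G^{\boxtimes n}\le\overline{K_2}^{\boxtimes k_n}\boxtimes H^{\boxtimes n}$ for all $n\in\mathbb N$. A sequence $a$ of nonempty graphs is approximately geometric with respect to $\lesssim$ if there is a sublinear sequence $(k_n)$ such that for all $t\in\mathbb N_{>0}$ and $n_1,\dots,n_t\in\mathbb N$ both $a_{n_1}\boxtimes\cdots\boxtimes a_{n_t}\lesssim\overline{K_2}^{\boxtimes(k_{n_1}+\dots+k_{n_t})}\boxtimes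 a_{n_1+\dots+n_t}$ and $a_{n_1+\dots+n_t}\lesssim\overline{K_2}^{\boxtimes(k_{n_1}+\dots+k_{n_t})}\boxtimes a_{n_1}\boxtimes\cdots\boxtimes a_{n_t}$ hold. $\operatorname{Hom}(\mathcal G,\mathbb R_{\ge0})$ is the set of semiring homomorphisms $f:\mathcal G\to\mathbb R_{\ge0}$ that are monotone ($G\le H\Rightarrow f(G)\le f(H)$). The asymptotic spectrum distance is the pseudometric $d(G,H)=\max_{f\in\operatorname{Hom}(\mathcal G,\mathbb R_{\ge0})}|f(G)-f(H)|$ on $\mathcal G$. *)

(* Defs.v *)
(* MathComp / MathComp-Analysis *)
From HB Require Import structures.
From mathcomp Require Import all_boot all_order all_algebra.
From mathcomp Require Import all_classical all_reals all_analysis.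

Set Implicit Arguments.
Unset Strict Implicit.
Unset Printing Implicit Defensive.

Import Order.TTheory GRing.Theory Num.Theory.
Import numFieldNormedType.Exports.

Local Open Scope classical_set_scope.
Local Open Scope ring_scope.

Record sgraph := SGraph {
  vertex :> finType;
  adj : rel vertex;
  adj_sym : symmetric adj;
  adj_irr : irreflexive adj
}.

Definition nonempty_graph (G : sgraph) : Prop := (0 < #|G|)%N.

Definition graph_iso (G H : sgraph) : Prop :=
  exists phi : G -> H, bijective phi /\ forall u v, adj (phi u) (phi v) = adj u v.

Definition graph_hom (G H : sgraph) : Prop :=
  exists phi : G -> H, forall u v, adj u v -> adj (phi u) (phi v).

Section Constructions.
Implicit Types G H : sgraph.

Definition edgeless_adj (r : nat) : rel 'I_r := fun _ _ => false.

Fact edgeless_sym r : symmetric (@edgeless_adj r).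
Proof. by []. Qed.

Fact edgeless_irr r : irreflexive (@edgeless_adj r).
Proof. by []. Qed.

Definition edgeless (r : nat) : sgraph :=
  SGraph (@edgeless_sym r) (@edgeless_irr r).

Definition compl_adj G : rel G := fun u v => (u != v) && ~~ adj u v.

Fact compl_sym G : symmetric (@compl_adj G).
Proof. by move=> u v; rewrite /compl_adj eq_sym adj_sym. Qed.

Fact compl_irr G : irreflexive (@compl_adj G).
Proof. by move=> u; rewrite /compl_adj eqxx. Qed.

Definition compl G : sgraph := SGraph (@compl_sym G) (@compl_irr G).

Definition disjoint_union_adj G H : rel (G + H)%type := fun x y =>
  match x, y with
  | inl u, inl v => adj u v
  | inr u, inr v => adj u v
  | _, _ => false
  end.

Fact disjoint_union_sym G H : symmetric (@disjoint_union_adj G H).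
Proof. by case=> u [] v //=; exact: adj_sym. Qed.

Fact disjoint_union_irr G H : irreflexive (@disjoint_union_adj G H).
Proof. by case=> u /=; exact: adj_irr. Qed.

Definition disjoint_union G H : sgraph :=
  SGraph (@disjoint_union_sym G H) (@disjoint_union_irr G H).

Definition strong_prod_adj G H : rel (G * H)%type := fun x y =>
  [&& x != y, (x.1 == y.1) || adj x.1 y.1 & (x.2 == y.2) || adj x.2 y.2].

Fact strong_prod_sym G H : symmetric (@strong_prod_adj G H).
Proof.
move=> x y; rewrite /strong_prod_adj (eq_sym x) (eq_sym x.1) (eq_sym x.2).
by rewrite (adj_sym x.1) (adj_sym x.2).
Qed.

Fact strong_prod_irr G H : irreflexive (@strong_prod_adj G H).
Proof. by move=> x; rewrite /strong_prod_adj eqxx. Qed.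

Definition strong_prod G H : sgraph :=
  SGraph (@strong_prod_sym G H) (@strong_prod_irr G H).

Definition strong_pow G (m : nat) : sgraph :=
  iter m (strong_prod G) (edgeless 1).

End Constructions.

Definition cohom_le (G H : sgraph) : Prop := graph_hom (compl G) (compl H).

(* The quotient k 0 / 0 is 0 by convention; it does not affect the limit. *)
Definition sublinear (R : realType) (k : nat -> nat) : Prop :=
  ((k n)%:R / n%:R : R) @[n --> \oo] --> (0 : R).

Definition asymp_le (R : realType) (G H : sgraph) : Prop :=
  exists k : nat -> nat, sublinear R k /\
    forall n, cohom_le (strong_pow G n)
      (strong_prod (strong_pow (edgeless 2) (k n)) (strong_pow H n)).

(* [le] is the preorder with respect to which [a] is approximately geometric.
   The big products are right-nested and end with a factor [edgeless 1] = K_1,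
   the unit of the strong product up to isomorphism. *)
Definition approx_geometric (R : realType) (le : sgraph -> sgraph -> Prop)
    (a : nat -> sgraph) : Prop :=
  exists k : nat -> nat, sublinear R k /\
    forall (t : nat) (n : 'I_t -> nat), (0 < t)%N ->
      le (\big[strong_prod/edgeless 1]_(i < t) a (n i))
         (strong_prod (strong_pow (edgeless 2) (\sum_(i < t) k (n i))%N)
                      (a (\sum_(i < t) n i)%N)) /\
      le (a (\sum_(i < t) n i)%N)
         (strong_prod (strong_pow (edgeless 2) (\sum_(i < t) k (n i))%N)
                      (\big[strong_prod/edgeless 1]_(i < t) a (n i))).

(* Functions on the semiring of isomorphism classes of graphs are represented
   by isomorphism-invariant functions on graphs; 0 and 1 of this semiring are
   the edgeless graphs on 0 and 1 vertices. *)
Record spectral_point (R : realType) (f : sgraph -> R) : Prop := SpectralPoint {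
  sp_ge0 : forall G, 0 <= f G;
  sp_iso : forall G H, graph_iso G H -> f G = f H;
  sp0 : f (edgeless 0) = 0;
  sp1 : f (edgeless 1) = 1;
  spD : forall G H, f (disjoint_union G H) = f G + f H;
  spM : forall G H, f (strong_prod G H) = f G * f H;
  sp_mono : forall G H, cohom_le G H -> f G <= f H
}.

(* The supremum is over a nonempty bounded set ([f G <= #|G|] for every
   spectral point [f]), and it is attained since the spectrum is compact. *)
Definition spectrum_dist (R : realType) (G H : sgraph) : R :=
  sup [set x : R | exists f : sgraph -> R, spectral_point f /\ x = `|f G - f H|].

Definition spectrum_cauchy (R : realType) (G : nat -> sgraph) : Prop :=
  forall e : R, 0 < e -> exists N : nat, forall m n : nat,
    (N <= m)%N -> (N <= n)%N -> spectrum_dist R (G m) (G n) < e.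

(* Main.v *)
Require Import Defs.
From HB Require Import structures.
From mathcomp Require Import all_boot all_order all_algebra.
From mathcomp Require Import all_classical all_reals all_analysis.
From mathcomp Require Import ring lra zify.

(* The key tool is Strassen's duality: if f G <= f H for every point f of the
   spectrum, then G is asymptotically below H.  If G^N is never below
   2^(N/n) H^N, then the relation 2 H^(2n) <= G^(2n) can be adjoined to the
   cohomomorphism preorder; a maximal extension of the result is total, and
   comparing with fractions gives a real-valued monotone homomorphism f with
   2 f(H)^(2n) <= f(G)^(2n).
   Given duality, a Cauchy sequence satisfies f(G_n)^n <= 2^(k_n) f(G_m)^n, and
   conversely, for all f and all m >= n, with k sublinear; since n_i is at most
   n_1 + ... + n_t, multiplying these bounds yields approximate geometricity.
   Conversely, using m copies of n and n copies of m, approximate geometricity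
   bounds f(G_n)/f(G_m) by 2^(k_n/n + k_m/m), uniformly in f. *)

Set Implicit Arguments.
Unset Strict Implicit.
Unset Printing Implicit Defensive.

Import Order.TTheory GRing.Theory Num.Theory.
Import numFieldNormedType.Exports.

Local Open Scope classical_set_scope.
Local Open Scope ring_scope.

(** * Strassen preorders *)

(** Given the other axioms, [spo_lt1D] amounts to the natural numbers being ordered as usual. The
    form with an arbitrary summand [c] is the one to check when a relation is adjoined, as summands
    need not cancel. *)
Record strassen_preorder (S : comPzSemiRingType) (P : S -> S -> Prop) : Prop := {
  spo_refl : forall x, P x x;
  spo_trans : forall y x z, P x y -> P y z -> P x z;
  spo_addr : forall z x y, P x y -> P (x + z) (y + z);
  spo_mulr : forall z x y, P x y -> P (x * z) (y * z);
  spo_ge0 : forall x, P 0 x;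
  spo_ge1 : forall x, x = 0 \/ P 1 x;
  spo_arch : forall x, exists n, P x n%:R;
  spo_lt1D : forall c, ~ P (1 + c) c
}.

Section StrassenPreorder.
Variables (S : comPzSemiRingType) (P : S -> S -> Prop).
Hypothesis sP : strassen_preorder P.

Lemma spo_addl z x y : P x y -> P (z + x) (z + y).
Proof. by rewrite ![z + _]addrC; exact: spo_addr. Qed.

Lemma spo_mull z x y : P x y -> P (z * x) (z * y).
Proof. by rewrite ![z * _]mulrC; exact: spo_mulr. Qed.

Lemma spo_add x y z w : P x y -> P z w -> P (x + z) (y + w).
Proof. by move=> /(spo_addr sP z) xy /(spo_addl y); exact: spo_trans. Qed.

Lemma spo_mul x y z w : P x y -> P z w -> P (x * z) (y * w).
Proof. by move=> /(spo_mulr sP z) xy /(spo_mull y); exact: spo_trans. Qed.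

Lemma spo_exp n x y : P x y -> P (x ^+ n) (y ^+ n).
Proof.
move=> xy; elim: n => [|n IH]; first exact: spo_refl.
by rewrite !exprS; exact: spo_mul.
Qed.

Lemma spo_exp_ge1 n x : P 1 x -> P 1 (x ^+ n).
Proof. by move/(spo_exp n); rewrite expr1n. Qed.

Lemma spo_leDr x y : P x (x + y).
Proof. by have := spo_addl x (spo_ge0 sP y); rewrite addr0. Qed.

Lemma spo_nat m n : P m%:R n%:R <-> (m <= n)%N.
Proof.
split=> [mn|/subnKC <-]; last by rewrite natrD; exact: spo_leDr.
rewrite leqNgt; apply/negP => /subnKC e.
apply: (spo_lt1D sP (c := n%:R)); apply: spo_trans mn => //.
by rewrite -e natrD -natr1 [_ + 1]addrC; exact: spo_leDr.
Qed.

(* Iterating, [N x + c <= N y + c] for all [N]; an [N] above [c] absorbs [c]. *)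
Lemma spo_cancel c x y : P 1 y -> P (x + c) (y + c) ->
  exists2 N, (0 < N)%N & P (N%:R * x) (N%:R * (2 * y)).
Proof.
move=> y1 xy; have [N cN] := spo_arch sP c; exists N.+1 => //.
have it n : P (n%:R * x + c) (n%:R * y + c).
  elim: n => [|n IH]; first by rewrite !mul0r; exact: spo_refl.
  have -> : n.+1%:R * x + c = n%:R * x + (x + c) by ring.
  apply: (spo_trans sP (spo_addl _ xy)).
  have -> : n%:R * x + (y + c) = (n%:R * x + c) + y by ring.
  have -> : n.+1%:R * y + c = (n%:R * y + c) + y by ring.
  exact: spo_addr.
apply: spo_trans (spo_leDr _ c) _ => //; apply: spo_trans (it _) _ => //.
have -> : N.+1%:R * (2 * y) = N.+1%:R * y + N.+1%:R * y by ring.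
apply: spo_addl; apply: (spo_trans sP cN).
rewrite -[X in P X]mulr1; apply: spo_mul => //; exact/spo_nat.
Qed.

(** Common summands cannot be cancelled, so factors [x] are exchanged for [y] one at a time and the
    leftover summand [d] is allowed to grow with [m]. *)
Lemma spo_exp_gap c s x y : P (s * x + c) (s * y + c) ->
  forall m, exists d, P (s * x ^+ m + d) (s * y ^+ m + d).
Proof.
move=> xy; elim=> [|m [d IH]]; first by exists 0; exact: spo_refl.
exists (d * x + c * y ^+ m); rewrite !exprSr addrA.
have -> : s * (x ^+ m * x) + d * x = (s * x ^+ m + d) * x by ring.
apply: spo_trans (spo_addr sP _ (spo_mulr sP _ IH)) _ => //.
have -> : (s * y ^+ m + d) * x + c * y ^+ m = (s * x + c) * y ^+ m + d * x by ring.
have -> : s * (y ^+ m * y) + (d * x + c * y ^+ m) = (s * y + c) * y ^+ m + d * x by ring.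
by apply: spo_addr => //; exact: spo_mulr.
Qed.

(** Exchanging one factor at a time keeps the coefficient [N] instead of raising it to [N ^ j]. *)
Lemma spo_natmul_exp N x y : P (N%:R * x) (N%:R * y) ->
  forall j, P (N%:R * x ^+ j) (N%:R * y ^+ j).
Proof.
move=> xy; elim=> [|j IH]; first exact: spo_refl.
rewrite !exprSr !mulrA; apply: spo_trans (spo_mulr sP _ IH) _ => //.
by rewrite mulrAC [N%:R * y ^+ j * y]mulrAC; exact: spo_mulr.
Qed.

(* The bound [R] on [s] does not depend on [m]. *)
Lemma spo_gap_exp c s x y : P 1 y -> P (1 + c + s * x) (c + s * y) ->
  exists R, forall m, exists2 j, (0 < j)%N &
    P (x ^+ (m * j)) ((2 ^+ R) ^+ j * y ^+ (m * j)).
Proof.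
move=> y1 xy; have [R sR] := spo_arch sP s.
(* With [s = 0] the gap would read [1 + c <= c]. *)
have s1 : P 1 s.
  case: (spo_ge1 sP s) => // s0; case: (spo_lt1D sP (c := c)).
  by move: xy; rewrite s0 !mul0r !addr0.
have xy' : P (s * x + c) (s * y + c).
  rewrite [s * y + c]addrC; apply: spo_trans xy => //.
  have -> : 1 + c + s * x = s * x + c + 1 by ring.
  exact: spo_leDr.
(* [2 ^+ R] bounds [s], one more factor 2 comes from [spo_cancel], and the last one, raised to the
   power [j = N], absorbs the coefficient [N <= 2 ^+ N]. *)
exists R.+2 => m; have [d gap] := spo_exp_gap xy' m.
have ym := spo_exp_ge1 m y1.
have sym : P 1 (s * y ^+ m) by rewrite -[1]mulr1; exact: spo_mul.
have [N N0 xyN] := spo_cancel sym gap.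
have N1 : P 1 N%:R by apply/(spo_nat 1).
exists N => //.
have le2 n : P n%:R (2 ^+ n).
  by rewrite -natrX; apply/spo_nat/ltnW/ltn_expl.
have sx z : P z (s * z) by rewrite -[X in P X]mul1r; exact: spo_mulr.
have {}xyN : P (N%:R * x ^+ m) (N%:R * (2 ^+ R.+1 * y ^+ m)).
  apply: spo_trans (spo_mull _ (sx _)) _ => //.
  apply: spo_trans xyN _ => //; apply: spo_mull.
  rewrite mulrA exprS; apply: spo_mulr => //; apply: spo_mull; exact: spo_trans sR (le2 R).
have := spo_natmul_exp xyN N; rewrite !exprM => xyNN.
apply: (@spo_trans _ _ sP (N%:R * (x ^+ m) ^+ N)).
  by rewrite -[X in P X]mul1r; exact: spo_mulr.
apply: (spo_trans sP xyNN).
rewrite [2 ^+ R.+2]exprS 2!exprMn mulrA.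
by apply: spo_mulr => //; apply: spo_mulr.
Qed.

End StrassenPreorder.

(* Forces [b <= a]: [s] copies of that inequality are added and cancelled. *)
Definition adjoin (S : comPzSemiRingType) (P : S -> S -> Prop) (a b x y : S) : Prop :=
  exists s, P (x + s * a) (y + s * b).

(** * Adjoining relations and maximal extensions *)

Section Extension.
Variables (S : comPzSemiRingType) (P : S -> S -> Prop).
Hypothesis sP : strassen_preorder P.

Lemma adjoin_sub a b x y : P x y -> adjoin P a b x y.
Proof. by move=> xy; exists 0; rewrite !mul0r !addr0. Qed.

Lemma adjoin_swap a b : adjoin P a b b a.
Proof. by exists 1; rewrite !mul1r addrC; exact: spo_refl. Qed.

(** The hypothesis is [spo_lt1D] of the extension spelled out; the other axioms are inherited from
    [P]. *)
Lemma adjoin_strassen a b :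
  (forall c s, ~ P (1 + c + s * a) (c + s * b)) ->
  strassen_preorder (adjoin P a b).
Proof.
move=> Nab; split.
- by move=> x; apply: adjoin_sub; exact: spo_refl.
- move=> y x z [s xy] [t yz]; exists (s + t).
  have -> : x + (s + t) * a = (x + s * a) + t * a by ring.
  apply: spo_trans (spo_addr sP _ xy) _ => //.
  have -> : y + s * b + t * a = (y + t * a) + s * b by ring.
  have -> : z + (s + t) * b = (z + t * b) + s * b by ring.
  exact: spo_addr.
- move=> z x y [s xy]; exists s.
  by rewrite ![_ + z + _]addrAC; exact: spo_addr.
(* Multiplication by [z] turns the coefficient [s] into [s * z], which is why coefficients are
   elements of [S] and not just natural numbers. *)
- move=> z x y [s xy]; exists (s * z).
  by rewrite ![s * z * _]mulrAC -!mulrDl; exact: spo_mulr.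
- by move=> x; apply: adjoin_sub; exact: spo_ge0.
- move=> x; have [->|x1] := spo_ge1 sP x; [by left | by right; exact: adjoin_sub].
- by move=> x; have [n xn] := spo_arch sP x; exists n; exact: adjoin_sub.
- by move=> c [s]; exact: Nab.
Qed.

Lemma maximal_strassen : exists Q : S -> S -> Prop,
  [/\ strassen_preorder Q, forall x y, P x y -> Q x y &
    forall Q' : S -> S -> Prop, strassen_preorder Q' ->
      (forall x y, Q x y -> Q' x y) -> forall x y, Q' x y -> Q x y].
Proof.
(* [Zorn_bigcup] also asks for the union of the empty chain: hence [P `|` _]. *)
pose join (A : set (S * S)) x y := P x y \/ A (x, y).
have [F FP Ftot|A [sA maxA]] :=
    @Zorn_bigcup (S * S)%type [set A | strassen_preorder (join A)].
- have [[A0 FA0]|F0] := pselect (exists A, F A); last first.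
    suff -> : [set A | strassen_preorder (join A)] (\bigcup_(X in F) X) =
              strassen_preorder P by [].
    congr strassen_preorder; apply/funext => x; apply/funext => y.
    apply/propext; split=> [[//|[A FA]]|]; last by left.
    by case: F0; exists A.
  have up A x y : F A -> join A x y -> join (\bigcup_(X in F) X) x y.
    by move=> FA [?|?]; [left | right; exists A].
  have down x y : join (\bigcup_(X in F) X) x y -> exists2 A, F A & join A x y.
    by case=> [?|[A FA Axy]]; [exists A0 => //; left | exists A => //; right].
  have sF A : F A -> strassen_preorder (join A) by move/FP.
  have incl A B x y : A `<=` B -> join A x y -> join B x y.
    by move=> AB [?|/AB ?]; [left | right].
  (* Every axiom assumes at most two instances of the relation, and these lie in a single member of
     the chain. *)
  split.
  + by move=> x; left; exact: spo_refl.
  + move=> y x z /down[A FA xy] /down[B FB yz].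
    have [AB|BA] := Ftot A B FA FB.
      by apply: (up B) => //; apply: (spo_trans (sF B FB)) yz; apply: incl xy.
    by apply: (up A) => //; apply: (spo_trans (sF A FA)) xy _; apply: incl yz.
  + by move=> z x y /down[A FA xy]; apply: (up A) => //; exact: spo_addr (sF A FA) _ _ _ xy.
  + by move=> z x y /down[A FA xy]; apply: (up A) => //; exact: spo_mulr (sF A FA) _ _ _ xy.
  + by move=> x; left; exact: spo_ge0.
  + by move=> x; have [|x1] := spo_ge1 sP x; [left | right; left].
  + by move=> x; have [n xn] := spo_arch sP x; exists n; left.
  + by move=> c /down[A FA]; exact: spo_lt1D (sF A FA) _.
- exists (join A); split=> //; first by move=> x y; left.
  move=> Q' sQ' AQ' x y Qxy; apply: contrapT => NA.
  apply: (maxA [set p | Q' p.1 p.2]).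
    split=> [[u v] Auv|QA]; first by apply: AQ'; right.
    by apply: NA; right; exact: (QA (x, y)).
  suff e : join [set p | Q' p.1 p.2] = Q' by rewrite /= e.
  apply/funext => u; apply/funext => v; apply/propext; split=> [[Puv|//]|]; last by right.
  by apply: AQ'; left.
Qed.

Hypothesis maxP : forall Q : S -> S -> Prop, strassen_preorder Q ->
  (forall x y, P x y -> Q x y) -> forall x y, Q x y -> P x y.

(** Adjoining [b <= a] would properly extend a maximal preorder, so some axiom must fail, and only
    [spo_lt1D] can. *)
Lemma maximal_gap a b : ~ P b a -> exists c s, P (1 + c + s * a) (c + s * b).
Proof.
move=> Nba; apply: contrapT => Ngap; apply: Nba.
apply: (maxP (Q := adjoin P a b)); last exact: adjoin_swap.
  by apply: adjoin_strassen => c s gap; apply: Ngap; exists c, s.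
by move=> x y; exact: adjoin_sub.
Qed.

Lemma maximal_total a b : P a b \/ P b a.
Proof.
apply: contrapT => /not_orP[/maximal_gap[c [s H1]] /maximal_gap[d [t H2]]].
have [s0|s1] := spo_ge1 sP s.
  by apply: (spo_lt1D sP (c := c)); move: H2 H1; rewrite s0 !mul0r !addr0.
(* Adding [t] times the first gap to [s] times the second puts the same terms in [a] and [b] on both
   sides: with [v] the right side, [s + v + t <= v], where [s >= 1]. *)
apply: (spo_lt1D sP (c := t * c + s * d + s * t * a + s * t * b)).
have := spo_add sP (spo_mull sP t H1) (spo_mull sP s H2).
set u := (X in P X _); set v := (X in P _ X) => uv.
have -> : t * c + s * d + s * t * a + s * t * b = v by rewrite /v; ring.
apply: spo_trans uv => //.
have -> : u = s + v + t by rewrite /u /v; ring.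
by apply: spo_trans (spo_leDr sP _ t) => //; exact: spo_addr.
Qed.

End Extension.

(** * Duality *)

Section Spectrum.
Variables (R : realType) (S : comPzSemiRingType).

Record spectral_hom (P : S -> S -> Prop) (f : S -> R) : Prop := {
  sh_ge0 : forall x, 0 <= f x;
  sh0 : f 0 = 0;
  sh1 : f 1 = 1;
  shD : forall x y, f (x + y) = f x + f y;
  shM : forall x y, f (x * y) = f x * f y;
  sh_mono : forall x y, P x y -> f x <= f y
}.

Lemma shX P f : spectral_hom P f -> forall n x, f (x ^+ n) = f x ^+ n.
Proof.
move=> sf n x; elim: n => [|n IH]; first by rewrite !expr0 (sh1 sf).
by rewrite !exprS (shM sf) IH.
Qed.

Lemma le_archimedean (x y c : R) :
  (forall q : nat, (0 < q)%N -> q%:R * x <= q%:R * y + c) -> x <= y.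
Proof.
move=> H; rewrite leNgt; apply/negP => yx.
have d0 : 0 < x - y by rewrite subr_gt0.
have [q qb] : exists q : nat, c / (x - y) < q%:R.
  by exists (Num.truncn `|c / (x - y)|).+1; apply: le_lt_trans (ler_norm _) (truncnS_gt _).
have q0 : 0 <= q%:R :> R by exact: ler0n.
have := H q.+1 isT; rewrite -natr1.
move: qb; rewrite ltr_pdivrMr // => qb; nra.
Qed.

Variable P : S -> S -> Prop.
Hypothesis sP : strassen_preorder P.
Hypothesis totP : forall a b, P a b \/ P b a.

(** The lower half of the Dedekind cut that [a] makes in the nonnegative rationals. *)
Definition lower_ratios (a : S) : set R :=
  [set x | exists p q : nat, [/\ (0 < q)%N, P p%:R (q%:R * a) & x = p%:R / q%:R]].

Definition order_hom (a : S) : R := sup (lower_ratios a).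

Lemma ratio_bound a p q x : (0 < q)%N -> P (q%:R * a) p%:R ->
  lower_ratios a x -> q%:R * x <= p%:R.
Proof.
move=> q0 qap [p' [q' [q'0 p'a ->]]].
rewrite mulrA ler_pdivrMr ?ltr0n// -!natrM ler_nat; apply/(spo_nat sP).
rewrite !natrM; apply: spo_trans (spo_mull sP _ p'a) _ => //.
by rewrite mulrCA mulrC; exact: spo_mulr.
Qed.

Lemma lower_ratios0 a : lower_ratios a 0.
Proof. by exists 0%N, 1%N; rewrite mul0r; split=> //; exact: spo_ge0. Qed.

Lemma lower_ratios_sup a : has_sup (lower_ratios a).
Proof.
split; first by exists 0; exact: lower_ratios0.
have [n an] := spo_arch sP a; exists n%:R => x xa.
by rewrite -[x]mul1r; apply: (@ratio_bound a n 1) => //; rewrite mul1r.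
Qed.

Lemma order_hom_lb a p q : P p%:R (q%:R * a) -> p%:R <= q%:R * order_hom a.
Proof.
have [->|q0] := posnP q.
  by rewrite !mul0r => /(spo_nat sP _ 0); rewrite lern0 leqn0.
move=> pa; rewrite mulrC -ler_pdivrMr ?ltr0n//.
by apply: (sup_upper_bound (lower_ratios_sup a)); exists p, q.
Qed.

Lemma order_hom_ub a p q : P (q%:R * a) p%:R -> q%:R * order_hom a <= p%:R.
Proof.
have [->|q0] := posnP q; first by rewrite !mul0r.
move=> ap; rewrite mulrC -ler_pdivlMr ?ltr0n//.
apply: ge_sup => [|x xa]; first by exists 0; exact: lower_ratios0.
by rewrite ler_pdivlMr ?ltr0n// mulrC; exact: ratio_bound xa.
Qed.

(** Totality turns the failure of [p + 1 <= q a] into [q a <= p + 1], so [q] times the supremum is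
    known up to 1. *)
Lemma order_hom_floor a q : exists2 p : nat, P p%:R (q%:R * a) & P (q%:R * a) p.+1%:R.
Proof.
have [n an] := spo_arch sP (q%:R * a).
have ex0 : exists p, `[< P p%:R (q%:R * a) >].
  by exists 0%N; apply/asboolP; exact: spo_ge0.
have bnd p : `[< P p%:R (q%:R * a) >] -> (p <= n)%N.
  by move=> /asboolP pa; apply/(spo_nat sP); exact: spo_trans pa an.
have [p /asboolP pa maxp] := ex_maxnP ex0 bnd.
exists p => //; have [//|/asboolP/maxp] := totP (q%:R * a) p.+1%:R.
by rewrite ltnn.
Qed.

(** At scale [q], integer parts determine both sides of each relation up to a controlled error,
    which vanishes relative to the scale as [q] grows. *)
Lemma order_hom_spectral : spectral_hom P order_hom.
Proof.
have ge0 x : 0 <= order_hom x.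
  by have := @order_hom_lb x 0 1; rewrite !mul1r; apply; exact: spo_ge0.
split=> //.
- apply/eqP; rewrite eq_le ge0 andbT.
  by have := @order_hom_ub 0 0 1; rewrite !mul1r; apply; exact: spo_refl.
- apply/eqP; rewrite eq_le; apply/andP; split.
    by have := @order_hom_ub 1 1 1; rewrite !mul1r; apply; exact: spo_refl.
  by have := @order_hom_lb 1 1 1; rewrite !mul1r; apply; exact: spo_refl.
- move=> x y.
  suff H q : (q%:R * order_hom (x + y) <= q%:R * (order_hom x + order_hom y) + 2) /\
      (q%:R * (order_hom x + order_hom y) <= q%:R * order_hom (x + y) + 2).
    apply/eqP; rewrite eq_le; apply/andP; split; apply: (@le_archimedean _ _ 2) => q _;
      by have [] := H q.
  have [m mx xm] := order_hom_floor x q; have [n ny yn] := order_hom_floor y q.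
  have := @order_hom_lb (x + y) (m + n) q.
  have := @order_hom_ub (x + y) (m.+1 + n.+1) q.
  rewrite !natrD !mulrDr => /(_ (spo_add sP xm yn)) h1 /(_ (spo_add sP mx ny)) h2.
  move: (order_hom_lb mx) (order_hom_ub xm) (order_hom_lb ny) (order_hom_ub yn) h1 h2.
  rewrite -!natr1; lra.
(* Products are compared at scale [q * q], where the error is [m + n + 1], at most [q * c]; one
   division by [q] leaves the constant [c]. *)
- move=> x y; set c := order_hom x + order_hom y + 1.
  suff H q : (0 < q)%N ->
      (q%:R * order_hom (x * y) <= q%:R * (order_hom x * order_hom y) + c) /\
      (q%:R * (order_hom x * order_hom y) <= q%:R * order_hom (x * y) + c).
    apply/eqP; rewrite eq_le; apply/andP; split; apply: (@le_archimedean _ _ c) => q /H;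
      by case.
  move=> q0; have [m mx xm] := order_hom_floor x q; have [n ny yn] := order_hom_floor y q.
  have := @order_hom_lb (x * y) (m * n) (q * q).
  have := @order_hom_ub (x * y) (m.+1 * n.+1) (q * q).
  have qq : q%:R * q%:R * (x * y) = (q%:R * x) * (q%:R * y) by ring.
  rewrite !natrM qq => /(_ (spo_mul sP xm yn)) h1 /(_ (spo_mul sP mx ny)) h2.
  move: (order_hom_lb mx) (order_hom_ub xm) (order_hom_lb ny) (order_hom_ub yn) h1 h2.
  rewrite -!natr1 /c.
  have : 1 <= q%:R :> R by rewrite ler1n.
  have := ge0 x; have := ge0 y; have : 0 <= m%:R :> R by []; have : 0 <= n%:R :> R by [].
  move: (order_hom x) (order_hom y) (order_hom (x * y)) (m%:R : R) (n%:R : R) (q%:R : R).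
  move=> X Y Z M N Q N0 M0 Y0 X0 Q1 mX Xm nY Yn h1 h2.
  have Q0 : 0 < Q by lra.
  split; rewrite -(ler_pM2l Q0).
    have : M * N <= (Q * X) * (Q * Y) by exact: ler_pM.
    nra.
  have : (Q * X) * (Q * Y) <= (M + 1) * (N + 1) by apply: ler_pM => //; nra.
  nra.
- move=> x y xy; apply: (@le_archimedean _ _ 1) => q _.
  have [m mx xm] := order_hom_floor x q.
  apply: le_trans (order_hom_ub xm) _; rewrite -natr1 lerD2r.
  by apply: order_hom_lb; apply: spo_trans mx _ => //; exact: spo_mull.
Qed.

End Spectrum.

Theorem strassen_duality (R : realType) (S : comPzSemiRingType)
    (P : S -> S -> Prop) (a b : S) :
  strassen_preorder P -> P 1 b ->
  (forall f : S -> R, spectral_hom P f -> f a <= f b) ->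
  forall n, exists N k, [/\ (0 < N)%N, (n * k <= N)%N & P (a ^+ N) (2 ^+ k * b ^+ N)].
Proof.
move=> sP b1 ab n.
(* For [n = 0] the bound on [k] is void, so any archimedean bound for [a] serves. *)
have [->|n0] := posnP n.
  have [r ar] := spo_arch sP a; exists 1%N, r; split=> //; rewrite !expr1.
  rewrite -[X in P X]mulr1; apply: spo_mul => //.
  by apply: spo_trans ar _ => //; rewrite -natrX; apply/(spo_nat sP)/ltnW/ltn_expl.
pose x := a ^+ (2 * n); pose y := 2 * b ^+ (2 * n).
have y1 : P 1 y.
  rewrite -[1]mulr1; apply: spo_mul => //; first exact/(spo_nat sP 1).
  exact: spo_exp_ge1.
have [[c [s gap]]|Ngap] := pselect (exists c s, P (1 + c + s * x) (c + s * y)); last first.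

  have sQ0 : strassen_preorder (adjoin P x y).
    by apply: adjoin_strassen => // c s gap; apply: Ngap; exists c, s.
  have [Q [sQ QP maxQ]] := maximal_strassen sQ0.
  have sf := order_hom_spectral R sQ (maximal_total sQ maxQ).
  set f := order_hom R Q in sf.
  have yx := sh_mono sf (QP _ _ (adjoin_swap sP x y)).
  have PQ u v : P u v -> Q u v by move=> uv; apply: QP; exact: adjoin_sub.
  have fab : f a <= f b.
    apply: ab; case: sf => ? ? ? ? ? mono; split=> // u v uv; exact/mono/PQ.
  (* Since [f b >= 1], the adjoined [2 f(b)^(2n) <= f(a)^(2n)] contradicts [f a <= f b]. *)
  have fb1 : 1 <= f b by rewrite -(sh1 sf); apply: (sh_mono sf); exact: PQ.
  have := lerXn2r (2 * n) (sh_ge0 sf a) (sh_ge0 sf b) fab.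
  move: yx (exprn_ege1 (2 * n) fb1).
  by rewrite /x /y (shM sf) !(shX sf) [2]/(1 + 1) (shD sf) (sh1 sf); lra.
(* The cost [r] of the gap is the same for all powers, so passing to the power [r.+1] outweighs it:
   [k = (2r + 1)j] against [N = 2n(r + 1)j]. *)
have [r gapr] := spo_gap_exp sP y1 gap; have [j j0] := gapr r.+1.
exists (2 * n * (r.+1 * j))%N, (r * j + r.+1 * j)%N; split; [by rewrite !muln_gt0 n0 j0 | by lia |].
have -> : 2 ^+ (r * j + r.+1 * j) * b ^+ (2 * n * (r.+1 * j)) =
    (2 ^+ r) ^+ j * y ^+ (r.+1 * j).
  by rewrite /y exprMn -!exprM exprD; ring.
by rewrite exprM.
Qed.

(** * The semiring of graphs *)

Section ClosedNeighbourhoods.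
Implicit Types G H K : sgraph.

(** Closed adjacency replaces complements: a cohomomorphism is a map that reflects it, and on a
    strong product it is a coordinatewise conjunction. *)
Definition cadj G : rel G := fun u v => (u == v) || adj u v.

Lemma cadj_edgeless r (u v : edgeless r) : cadj u v = (u == v).
Proof. by rewrite /cadj orbF. Qed.

Lemma cadj_prod G H (x y : strong_prod G H) :
  cadj x y = cadj x.1 y.1 && cadj x.2 y.2.
Proof.
case: x y => [u v] [w z]; rewrite /cadj /= /strong_prod_adj /=.
have [[-> ->]|ne //] := eqVneq (u, v) (w, z).
by rewrite !eqxx.
Qed.

Lemma cadj_inl G H (u v : G) : cadj (inl u : disjoint_union G H) (inl v) = cadj u v.
Proof. by []. Qed.

Lemma cadj_inr G H (u v : H) : cadj (inr u : disjoint_union G H) (inr v) = cadj u v.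
Proof. by []. Qed.

Lemma cohom_leP G H :
  cohom_le G H <-> exists phi : G -> H, forall u v, cadj (phi u) (phi v) -> cadj u v.
Proof.
have NE K (u v : K) : ~~ cadj u v = (@compl_adj K u v) by rewrite negb_or.
split=> -[phi hphi]; exists phi => u v; last first.
  by rewrite /adj /= -!NE; apply: contra; exact: hphi.
by apply: contraLR; rewrite !NE; exact: hphi.
Qed.

Lemma cohom_refl G : cohom_le G G.
Proof. by exists id. Qed.

Lemma cohom_trans H G K : cohom_le G H -> cohom_le H K -> cohom_le G K.
Proof. by move=> [f hf] [g hg]; exists (g \o f) => u v /hf/hg. Qed.

Lemma iso_cohom_le G H : graph_iso G H -> cohom_le G H /\ cohom_le H G.
Proof.
move=> [phi [bphi hphi]]; have [psi phiK psiK] := bphi.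
split; apply/cohom_leP; [exists phi | exists psi] => u v; rewrite /cadj.
  by rewrite hphi (can_eq phiK).
by rewrite (can_eq psiK) -hphi !psiK.
Qed.

Lemma cohom_union G G' H H' : cohom_le G G' -> cohom_le H H' ->
  cohom_le (disjoint_union G H) (disjoint_union G' H').
Proof.
move=> /cohom_leP[f hf] /cohom_leP[g hg]; apply/cohom_leP.
exists (fun x => match x with inl u => inl (f u) | inr v => inr (g v) end).
by move=> [u|u] [v|v] //; [exact: hf | exact: hg].
Qed.

Lemma cohom_prod G G' H H' : cohom_le G G' -> cohom_le H H' ->
  cohom_le (strong_prod G H) (strong_prod G' H').
Proof.
move=> /cohom_leP[f hf] /cohom_leP[g hg]; apply/cohom_leP.
exists (fun x => (f x.1, g x.2)) => x y; rewrite !cadj_prod /=.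
by move=> /andP[/hf-> /hg->].
Qed.

Lemma cohom_unionA G H K :
  cohom_le (disjoint_union G (disjoint_union H K)) (disjoint_union (disjoint_union G H) K).
Proof.
apply/cohom_leP; exists (fun x => match x with
  | inl u => inl (inl u) | inr (inl u) => inl (inr u) | inr (inr u) => inr u end).
by move=> [u|[u|u]] [v|[v|v]].
Qed.

Lemma cohom_unionA' G H K :
  cohom_le (disjoint_union (disjoint_union G H) K) (disjoint_union G (disjoint_union H K)).
Proof.
apply/cohom_leP; exists (fun x => match x with
  | inl (inl u) => inl u | inl (inr u) => inr (inl u) | inr u => inr (inr u) end).
by move=> [[u|u]|u] [[v|v]|v].
Qed.

Lemma cohom_unionC G H : cohom_le (disjoint_union G H) (disjoint_union H G).
Proof.
apply/cohom_leP; exists (fun x => match x with inl u => inr u | inr u => inl u end).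
by move=> [u|u] [v|v].
Qed.

Lemma cohom_0 G : cohom_le (edgeless 0) G.
Proof.
by apply/cohom_leP; exists (fun i : 'I_0 => False_rect G (notF (ltn_ord i))) => -[].
Qed.

Lemma cohom_union0 G : cohom_le (disjoint_union (edgeless 0) G) G.
Proof.
apply/cohom_leP; exists (fun x : 'I_0 + G => match x with
  | inl i => False_rect G (notF (ltn_ord i)) | inr u => u end).
by move=> [[]//|u] [[]//|v].
Qed.

Lemma cohom_union_inr G H : cohom_le H (disjoint_union G H).
Proof. by apply/cohom_leP; exists inr. Qed.

Lemma cohom_prodA G H K :
  cohom_le (strong_prod G (strong_prod H K)) (strong_prod (strong_prod G H) K).
Proof.
apply/cohom_leP; exists (fun x => ((x.1, x.2.1), x.2.2)) => x y.
by rewrite !cadj_prod /= andbA.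
Qed.

Lemma cohom_prodA' G H K :
  cohom_le (strong_prod (strong_prod G H) K) (strong_prod G (strong_prod H K)).
Proof.
apply/cohom_leP; exists (fun x => (x.1.1, (x.1.2, x.2))) => x y.
by rewrite !cadj_prod /= andbA.
Qed.

Lemma cohom_prodC G H : cohom_le (strong_prod G H) (strong_prod H G).
Proof.
apply/cohom_leP; exists (fun x => (x.2, x.1)) => x y.
by rewrite !cadj_prod /= andbC.
Qed.

Lemma cohom_prod1 G : cohom_le (strong_prod (edgeless 1) G) G.
Proof.
apply/cohom_leP; exists snd => x y.
by rewrite cadj_prod cadj_edgeless (ord1 x.1) (ord1 y.1) eqxx.
Qed.

Lemma cohom_prod1' G : cohom_le G (strong_prod (edgeless 1) G).
Proof.
by apply/cohom_leP; exists (pair ord0) => x y; rewrite cadj_prod => /andP[].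
Qed.

Lemma cohom_prod0 G : cohom_le (strong_prod (edgeless 0) G) (edgeless 0).
Proof. by apply/cohom_leP; exists fst => -[[]]. Qed.

Lemma cohom_prodDl G H K : cohom_le (strong_prod (disjoint_union G H) K)
  (disjoint_union (strong_prod G K) (strong_prod H K)).
Proof.
apply/cohom_leP; exists (fun x => match x.1 with
  | inl u => inl (u, x.2) | inr u => inr (u, x.2) end).
by move=> [[u|u] x] [[v|v] y]; rewrite ?cadj_inl ?cadj_inr ?cadj_prod.
Qed.

Lemma cohom_prodDl' G H K : cohom_le
  (disjoint_union (strong_prod G K) (strong_prod H K))
  (strong_prod (disjoint_union G H) K).
Proof.
apply/cohom_leP; exists (fun x => match x with
  | inl u => (inl u.1, u.2) | inr u => (inr u.1, u.2) end).
by move=> [[u x]|[u x]] [[v y]|[v y]]; rewrite ?cadj_inl ?cadj_inr !cadj_prod.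
Qed.

Lemma cohom_edgeless_card G : cohom_le G (edgeless #|G|).
Proof.
apply/cohom_leP; exists (fun u => enum_rank u : edgeless #|G|) => u v.
by rewrite cadj_edgeless (inj_eq enum_rank_inj) => /eqP->; rewrite /cadj eqxx.
Qed.

Lemma cohom_1 G : nonempty_graph G -> cohom_le (edgeless 1) G.
Proof.
move=> /card_gt0P[x _]; apply/cohom_leP; exists (fun=> x) => u v _.
by rewrite cadj_edgeless (ord1 u) (ord1 v).
Qed.

Lemma cohom_edgelessS n : cohom_le (edgeless n.+1) (disjoint_union (edgeless 1) (edgeless n)).
Proof.
apply/cohom_leP; exists (fun i : 'I_(1 + n) => fintype.split i) => u v.
rewrite cadj_edgeless /cadj; case: eqP => [e _|_] //=.
  exact/eqP/(can_inj (@fintype.splitK 1 n) e).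
by case: (@fintype.split 1 n u) (@fintype.split 1 n v) => [i|i] [j|j].
Qed.

Lemma cohom_edgelessS' n : cohom_le (disjoint_union (edgeless 1) (edgeless n)) (edgeless n.+1).
Proof.
apply/cohom_leP; exists (fun x : 'I_1 + 'I_n => unsplit x : 'I_(1 + n)) => u v.
by rewrite cadj_edgeless (can_eq (@unsplitK 1 n)) /cadj => /eqP->; rewrite eqxx.
Qed.

Lemma cohom_edgeless_le m n : cohom_le (edgeless m) (edgeless n) -> (m <= n)%N.
Proof.
move=> /cohom_leP[f hf]; rewrite -(card_ord m) -(card_ord n).
apply: (@leq_card _ _ f) => u v e.
by apply/eqP; rewrite -cadj_edgeless; apply: hf; rewrite e /cadj eqxx.
Qed.

End ClosedNeighbourhoods.

(* [sgraph] lives above the universe of the carriers of MathComp structures,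
   so that classes are taken in a small type of graphs on [0, n). *)
Record graph_code := GraphCode {
  code_size : nat;
  code_rel : 'I_code_size -> 'I_code_size -> bool
}.

HB.instance Definition _ := gen_eqMixin graph_code.
HB.instance Definition _ := gen_choiceMixin graph_code.

Definition decode_adj (c : graph_code) : rel 'I_(code_size c) :=
  fun u v => (u != v) && (code_rel u v || code_rel v u).

Fact decode_sym c : symmetric (@decode_adj c).
Proof. by move=> u v; rewrite /decode_adj eq_sym orbC. Qed.

Fact decode_irr c : irreflexive (@decode_adj c).
Proof. by move=> u; rewrite /decode_adj eqxx. Qed.

Definition decode (c : graph_code) : sgraph := SGraph (@decode_sym c) (@decode_irr c).

Definition encode (G : sgraph) : graph_code :=
  @GraphCode #|G| (fun i j => adj (enum_val i) (enum_val j)).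

Lemma decode_encode G : graph_iso (decode (encode G)) G.
Proof.
exists enum_val; split; first exact: enum_val_bij.
move=> u v; rewrite /= /decode_adj /= [adj (enum_val v) _]adj_sym orbb.
by case: eqP => // ->; rewrite adj_irr.
Qed.

Definition code_eq (c d : graph_code) : bool :=
  `[< cohom_le (decode c) (decode d) /\ cohom_le (decode d) (decode c) >].

Lemma code_eqP c d : reflect
  (cohom_le (decode c) (decode d) /\ cohom_le (decode d) (decode c)) (code_eq c d).
Proof. exact: asboolP. Qed.

Lemma code_eq_refl : reflexive code_eq.
Proof. by move=> c; apply/code_eqP; split; exact: cohom_refl. Qed.

Lemma code_eq_sym : symmetric code_eq.
Proof. by move=> c d; apply/code_eqP/code_eqP => -[]. Qed.

Lemma code_eq_trans : transitive code_eq.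
Proof.
move=> d c e /code_eqP[cd dc] /code_eqP[de ed].
by apply/code_eqP; split; apply: (@cohom_trans (decode d)).
Qed.

Canonical code_equiv := EquivRel code_eq code_eq_refl code_eq_sym code_eq_trans.
Canonical code_enc := defaultEncModRel code_eq.

(** * The semiring of cohomomorphism classes *)

Local Open Scope quotient_scope.

(* Mutual cohomomorphism is coarser than isomorphism, but every monotone
   function factors through the quotient, which is a semiring. *)
Definition cohom_class := {eq_quot code_eq}.
HB.instance Definition _ := Choice.on cohom_class.
HB.instance Definition _ := EqQuotient.on cohom_class.

Definition gclass (G : sgraph) : cohom_class := \pi_(cohom_class) (encode G).
Definition class_repr (x : cohom_class) : sgraph := decode (repr x).

Lemma repr_gclass G :
  cohom_le (class_repr (gclass G)) G /\ cohom_le G (class_repr (gclass G)).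
Proof.
have [h1 h2] := iso_cohom_le (decode_encode G).
have /eqmodP/code_eqP[h3 h4] : repr (gclass G) = encode G %[mod cohom_class].
  by rewrite reprK.
by split; [exact: cohom_trans h1 | exact: cohom_trans h4].
Qed.

Lemma gclass_eq G H : cohom_le G H -> cohom_le H G -> gclass G = gclass H.
Proof.
move=> GH HG; have [g1 g2] := iso_cohom_le (decode_encode G).
have [h1 h2] := iso_cohom_le (decode_encode H).
apply/eqmodP/code_eqP; split.
  exact: cohom_trans g1 (cohom_trans GH h2).
exact: cohom_trans h1 (cohom_trans HG g2).
Qed.

Lemma gclass_ind (Q : cohom_class -> Prop) : (forall G, Q (gclass G)) -> forall x, Q x.
Proof.
move=> QG x; suff -> : x = gclass (class_repr x) by [].
rewrite -[x in LHS]reprK; apply/eqmodP/code_eqP.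
by have [] := iso_cohom_le (decode_encode (class_repr x)).
Qed.

Definition class_add (x y : cohom_class) := gclass (disjoint_union (class_repr x) (class_repr y)).
Definition class_mul (x y : cohom_class) := gclass (strong_prod (class_repr x) (class_repr y)).
Definition class_le (x y : cohom_class) := cohom_le (class_repr x) (class_repr y).

Lemma class_addE G H : class_add (gclass G) (gclass H) = gclass (disjoint_union G H).
Proof.
have [? ?] := repr_gclass G; have [? ?] := repr_gclass H.
by apply: gclass_eq; exact: cohom_union.
Qed.

Lemma class_mulE G H : class_mul (gclass G) (gclass H) = gclass (strong_prod G H).
Proof.
have [? ?] := repr_gclass G; have [? ?] := repr_gclass H.
by apply: gclass_eq; exact: cohom_prod.
Qed.

Lemma class_leE G H : class_le (gclass G) (gclass H) <-> cohom_le G H.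
Proof.
have [h1 h2] := repr_gclass G; have [h3 h4] := repr_gclass H; split=> [GH|GH].
  exact: cohom_trans h2 (cohom_trans GH h3).
exact: cohom_trans h1 (cohom_trans GH h4).
Qed.

Lemma class_addA : associative class_add.
Proof.
elim/gclass_ind=> G; elim/gclass_ind=> H; elim/gclass_ind=> K.
by rewrite !class_addE; apply: gclass_eq; [exact: cohom_unionA | exact: cohom_unionA'].
Qed.

Lemma class_addC : commutative class_add.
Proof.
elim/gclass_ind=> G; elim/gclass_ind=> H.
by rewrite !class_addE; apply: gclass_eq; exact: cohom_unionC.
Qed.

Lemma class_add0 : left_id (gclass (edgeless 0)) class_add.
Proof.
elim/gclass_ind=> G.
by rewrite class_addE; apply: gclass_eq; [exact: cohom_union0 | exact: cohom_union_inr].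
Qed.

Lemma class_mulA : associative class_mul.
Proof.
elim/gclass_ind=> G; elim/gclass_ind=> H; elim/gclass_ind=> K.
by rewrite !class_mulE; apply: gclass_eq; [exact: cohom_prodA | exact: cohom_prodA'].
Qed.

Lemma class_mulC : commutative class_mul.
Proof.
elim/gclass_ind=> G; elim/gclass_ind=> H.
by rewrite !class_mulE; apply: gclass_eq; exact: cohom_prodC.
Qed.

Lemma class_mul1 : left_id (gclass (edgeless 1)) class_mul.
Proof.
elim/gclass_ind=> G.
by rewrite class_mulE; apply: gclass_eq; [exact: cohom_prod1 | exact: cohom_prod1'].
Qed.

Lemma class_mulDl : left_distributive class_mul class_add.
Proof.
elim/gclass_ind=> G; elim/gclass_ind=> H; elim/gclass_ind=> K.
rewrite (class_addE G H) !class_mulE class_addE.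
by apply: gclass_eq; [exact: cohom_prodDl | exact: cohom_prodDl'].
Qed.

Lemma class_mul0 : left_zero (gclass (edgeless 0)) class_mul.
Proof.
elim/gclass_ind=> G.
by rewrite class_mulE; apply: gclass_eq; [exact: cohom_prod0 | exact: cohom_0].
Qed.

HB.instance Definition _ := GRing.isNmodule.Build cohom_class
  class_addA class_addC class_add0.
HB.instance Definition _ := GRing.Nmodule_isComPzSemiRing.Build cohom_class
  class_mulA class_mulC class_mul1 class_mulDl class_mul0.

Lemma gclass_union G H : gclass (disjoint_union G H) = gclass G + gclass H.
Proof. by rewrite -class_addE. Qed.

Lemma gclass_prod G H : gclass (strong_prod G H) = gclass G * gclass H.
Proof. by rewrite -class_mulE. Qed.

Lemma gclass_edgeless n : gclass (edgeless n) = n%:R.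
Proof.
elim: n => [//|n IH]; rewrite -natr1 addrC -IH.
rewrite -[1]/(gclass (edgeless 1)) -gclass_union.
by apply: gclass_eq; [exact: cohom_edgelessS | exact: cohom_edgelessS'].
Qed.

Lemma gclass_pow G n : gclass (strong_pow G n) = gclass G ^+ n.
Proof. by elim: n => [//|n IH]; rewrite /= gclass_prod IH exprS. Qed.

Lemma class_le_strassen : strassen_preorder class_le.
Proof.
have tr x y z : class_le x y -> class_le y z -> class_le x z.
  exact: cohom_trans.
have addr z x y : class_le x y -> class_le (x + z) (y + z).
  by move=> xy; apply/class_leE/cohom_union => //; exact: cohom_refl.
have ge0 x : class_le 0 x by elim/gclass_ind: x => G; apply/class_leE/cohom_0.
have arch x : exists n, class_le x n%:R.
  elim/gclass_ind: x => G; exists #|G|; rewrite -gclass_edgeless.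
  exact/class_leE/cohom_edgeless_card.
split=> //.
- by move=> x; exact: cohom_refl.
- by move=> y x z; exact: cohom_trans.
- by move=> z x y xy; apply/class_leE/cohom_prod => //; exact: cohom_refl.
- elim/gclass_ind=> G; have [G0|] := posnP #|G|.
    left; apply: gclass_eq; last exact: cohom_0.
    by have := cohom_edgeless_card G; rewrite G0.
  by move=> G0; right; apply/class_leE/cohom_1.
(* As [c <= n], iterating [1 + c <= c] yields [n + 1 <= n], which the pigeonhole principle excludes
   for edgeless graphs. *)
- move=> c le1c; have [n cn] := arch c.
  have it m : class_le (m%:R + c) c.
    elim: m => [|m IH]; first by rewrite add0r; exact: cohom_refl.
    by rewrite -natr1 -addrA; apply: (tr _ _ _ _ IH); rewrite ![m%:R + _]addrC; exact: addr.
  suff : (n.+1 <= n)%N by rewrite ltnn.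
  apply/cohom_edgeless_le/class_leE; rewrite !gclass_edgeless.
  apply: (tr _ _ _ _ cn); apply: (tr _ _ _ _ (it n.+1)).
  by have := addr n.+1%:R 0 c (ge0 c); rewrite add0r addrC.
Qed.

(** * The asymptotic spectrum of graphs *)

Section SubexponentialRates.
Variables (S : comPzSemiRingType) (P : S -> S -> Prop).
Hypothesis sP : strassen_preorder P.

(* The least exponents are subadditive, whence it suffices to bound one of them. *)
Lemma subexponential_rate a b : P 1 b ->
  (forall q, exists N k, [/\ (0 < N)%N, (q * k <= N)%N & P (a ^+ N) (2 ^+ k * b ^+ N)]) ->
  exists k : nat -> nat,
    (forall q, exists N, forall n, (N <= n)%N -> (q * k n <= n)%N) /\
    forall n, P (a ^+ n) (2 ^+ k n * b ^+ n).
Proof.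
move=> b1 rate.
have [r ar0] := spo_arch sP a.
have ar : P a (2 ^+ r).
  by apply: (spo_trans sP ar0); rewrite -natrX; apply/(spo_nat sP)/ltnW/ltn_expl.
have arn n : P (a ^+ n) (2 ^+ (r * n) * b ^+ n).
  rewrite -[a ^+ n]mulr1 exprM; apply: spo_mul => //; first exact: spo_exp.
  exact: spo_exp_ge1.
have ex n : exists k, `[< P (a ^+ n) (2 ^+ k * b ^+ n) >].
  by exists (r * n)%N; apply/asboolP.
exists (fun n => ex_minn (ex n)); split=> [q|n]; last by case: ex_minnP => k /asboolP.
have [N [k [N0 kN aN]]] := rate (2 * q)%N.
(* Writing [n = d N + m] with [m < N], the least exponent is at most [k d + r m]. Multiplied by [q],
   each summand is at most [n / 2]: the first by [2 q k <= N], the second by this threshold. *)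
exists (2 * q * r * N)%N => n nN; case: ex_minnP => k' _.
move=> /(_ (k * (n %/ N) + r * (n %% N))%N) mink.
have := ltn_mod n N; rewrite N0; have := divn_eq n N.
move: (n %/ N)%N (n %% N)%N mink => d m mink nE mN.
have {mink} k'le : (k' <= k * d + r * m)%N.
  apply: mink; apply/asboolP; rewrite nE.
  have -> : 2 ^+ (k * d + r * m) * b ^+ (d * N + m) =
    (2 ^+ k * b ^+ N) ^+ d * (2 ^+ (r * m) * b ^+ m).
    by rewrite [(d * N)%N]mulnC !exprD exprMn !exprM; ring.
  rewrite exprD mulnC exprM; apply: spo_mul => //; exact: spo_exp.
have : (q * k' <= q * (k * d + r * m))%N by rewrite leq_mul2l k'le orbT.
have : (2 * q * k * d <= N * d)%N by rewrite leq_mul2r kN orbT.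
have : (q * r * m <= q * r * N)%N by rewrite leq_mul2l ltnW ?orbT.
nia.
Qed.

End SubexponentialRates.

(** * Sublinear sequences and roots of inequalities *)

Section RealEstimates.
Variable R : realType.

Lemma sublinearP (k : nat -> nat) : sublinear R k <->
  forall q, exists N, forall n, (N <= n)%N -> (q * k n <= n)%N.
Proof.
split=> [/cvgrPdist_lt kl q|H].
  have [|N _ hN] := kl (q.+1%:R^-1); first by rewrite invr_gt0 ltr0n.
  (* Starting at [N.+1] leaves out the index 0, where the quotient is 0 by convention. *)
  exists N.+1 => -[//|n] nN; have := hN n.+1 (ltnW nN).
  rewrite /= sub0r normrN ger0_norm ?divr_ge0// ltr_pdivrMr ?ltr0n// mulrC.
  rewrite ltr_pdivlMr ?ltr0n// -natrM ltr_nat => /ltnW; apply: leq_trans.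
  by rewrite mulnC leq_mul2l leqnSn orbT.
apply/cvgrPdist_lt => e e0.
have [q qe] : exists q : nat, e^-1 < q%:R.
  by exists (Num.truncn e^-1).+1; exact: truncnS_gt.
have q0 : 0 < q%:R :> R by apply: lt_trans qe; rewrite invr_gt0.
have [N hN] := H q; exists N.+1 => // -[//|n] /= /ltnW /hN qk.
rewrite sub0r normrN ger0_norm ?divr_ge0// ltr_pdivrMr ?ltr0n//.
have : q%:R * (k n.+1)%:R <= n.+1%:R :> R by rewrite -natrM ler_nat.
have : 1 < e * q%:R by rewrite mulrC -ltr_pdivrMr// mul1r.
have : 0 < n.+1%:R :> R by rewrite ltr0n.
have : 0 <= (k n.+1)%:R :> R by [].
nra.
Qed.

Lemma bernoulli (d : R) n : -1 <= d -> 1 + n%:R * d <= (1 + d) ^+ n.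
Proof.
move=> d1; elim: n => [|n IH]; first by rewrite mul0r addr0 expr0.
rewrite exprS -natr1; have : 0 <= n%:R :> R by [].
have := ler_wpM2l (_ : 0 <= 1 + d) IH; nra.
Qed.

(** Bernoulli's inequality at [x / y - 1] linearises the [q]-th root of [c]. *)
Lemma root_gap (x y c : R) q : 0 <= x -> 0 < y -> x ^+ q <= c * y ^+ q ->
  q%:R * x <= q%:R * y + (c - 1) * y.
Proof.
move=> x0 y0 xy.
have xE : 1 + (x / y - 1) = x / y by ring.
have := @bernoulli (x / y - 1) q; rewrite xE expr_div_n => /(_ _)/le_trans H.
have : 1 + q%:R * (x / y - 1) <= c.
  apply: H; last by rewrite ler_pdivrMr ?exprn_gt0.
  by have := divr_ge0 x0 (ltW y0); lra.
have := divfK (lt0r_neq0 y0) x; move: (x / y) => z <-; nra.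
Qed.

Lemma root_le (x y : R) : 0 <= x -> 0 < y -> (forall q, x ^+ q <= 2 * y ^+ q) -> x <= y.
Proof.
move=> x0 y0 xy; apply: (@le_archimedean _ _ _ y) => q _.
by have := root_gap x0 y0 (xy q); lra.
Qed.

(** Raise the hypothesis to the power [q], bound [2 ^+ (k * q)] by [2 ^+ n], and take [n]-th
    roots. *)
Lemma root_of_pow (x y : R) n k q : 0 <= x -> 0 <= y -> (0 < n)%N ->
  (q * k <= n)%N -> x ^+ n <= 2 ^+ k * y ^+ n -> x ^+ q <= 2 * y ^+ q.
Proof.
move=> x0 y0 n0 kn xy.
have y2 : 0 <= 2 * y ^+ q by rewrite mulr_ge0 ?exprn_ge0.
rewrite -(ler_pXn2r n0) ?nnegrE ?exprn_ge0// exprAC exprMn.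
apply: (@le_trans _ _ ((2 ^+ k * y ^+ n) ^+ q)).
  by apply: lerXn2r; rewrite ?nnegrE ?mulr_ge0 ?exprn_ge0.
rewrite exprMn -[(y ^+ n) ^+ q]exprAC ler_wpM2r ?exprn_ge0// -exprM mulnC.
by rewrite ler_weXn2l// ler1n.
Qed.

End RealEstimates.

(** * Spectral points and the asymptotic preorder *)

Section SpectralPoints.
Variables (R : realType) (f : sgraph -> R).
Hypothesis sf : spectral_point f.

Lemma sp_edgeless n : f (edgeless n) = n%:R.
Proof.
elim: n => [|n IH]; first exact: sp0.
rewrite -natr1 addrC -{1}(sp1 sf) -IH -(spD sf).
apply/eqP; rewrite eq_le; apply/andP; split; apply: (sp_mono sf).
  exact: cohom_edgelessS.
exact: cohom_edgelessS'.
Qed.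

Lemma sp_pow G n : f (strong_pow G n) = f G ^+ n.
Proof. by elim: n => [|n IH]; rewrite ?expr0 ?(sp1 sf)//= (spM sf) IH exprS. Qed.

Lemma sp_big t (F : 'I_t -> sgraph) :
  f (\big[strong_prod/edgeless 1]_(i < t) F i) = \prod_(i < t) f (F i).
Proof. exact: (big_morph f (spM sf) (sp1 sf)). Qed.

Lemma sp_le_card G : f G <= #|G|%:R.
Proof. by rewrite -sp_edgeless; apply/(sp_mono sf)/cohom_edgeless_card. Qed.

Lemma sp_ge1 G : nonempty_graph G -> 1 <= f G.
Proof. by move=> G0; rewrite -(sp1 sf); apply/(sp_mono sf)/cohom_1. Qed.

(** For each [q], a single index [n] with [q * k n <= n] gives [f(G)^q <= 2 f(H)^q]; the constant 2
    disappears as [q] grows. *)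
Lemma sp_asymp_le G H : nonempty_graph H -> asymp_le R G H -> f G <= f H.
Proof.
move=> H0 [k [/sublinearP kl GH]].
have fH : 0 < f H := lt_le_trans ltr01 (sp_ge1 H0).
apply: root_le => // [|q]; first exact: sp_ge0.
have [N /(_ N.+1 (leqnSn N)) qN] := kl q.
apply: root_of_pow qN _ => //; [exact: sp_ge0 | exact: ltW |].
by have := sp_mono sf (GH N.+1); rewrite (spM sf) !sp_pow sp_edgeless.
Qed.

End SpectralPoints.

Lemma spectral_point_class (R : realType) (f : cohom_class -> R) :
  spectral_hom class_le f -> spectral_point (f \o gclass).
Proof.
move=> sf; split=> /=.
- by move=> G; exact: sh_ge0 sf _.
- by move=> G H /iso_cohom_le[GH HG]; rewrite (gclass_eq GH HG).
- exact: sh0 sf.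
- exact: sh1 sf.
- by move=> G H; rewrite gclass_union (shD sf).
- by move=> G H; rewrite gclass_prod (shM sf).
- by move=> G H GH; apply/(sh_mono sf)/class_leE.
Qed.

(** Duality in the semiring of classes provides exponents of arbitrarily small rate, and
    [subexponential_rate] merges them into one sublinear sequence. *)
Lemma asymp_duality (R : realType) (G H : sgraph) : nonempty_graph H ->
  (forall f : sgraph -> R, spectral_point f -> f G <= f H) -> asymp_le R G H.
Proof.
move=> H0 GH.
have H1 : class_le 1 (gclass H) by apply/class_leE/cohom_1.
have dual := strassen_duality class_le_strassen H1
  (fun f sf => GH _ (@spectral_point_class R f sf)).
have [k [kl kP]] := subexponential_rate class_le_strassen H1 dual.
exists k; split=> [|n]; first exact/sublinearP.
by apply/class_leE; rewrite gclass_prod !gclass_pow gclass_edgeless.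
Qed.

Lemma nonempty_prod G H : nonempty_graph G -> nonempty_graph H ->
  nonempty_graph (strong_prod G H).
Proof. by rewrite /nonempty_graph card_prod muln_gt0 => -> ->. Qed.

Lemma nonempty_edgeless n : nonempty_graph (edgeless n.+1).
Proof. by rewrite /nonempty_graph card_ord. Qed.

Lemma nonempty_pow G n : nonempty_graph G -> nonempty_graph (strong_pow G n).
Proof.
move=> G0; elim: n => [|n IH]; first exact: nonempty_edgeless.
exact: nonempty_prod.
Qed.

(** * Bounds for the spectrum distance *)

Section SpectrumDistance.
Variable R : realType.

Lemma spectrum_dist_ub G H (f : sgraph -> R) :
  spectral_point f -> `|f G - f H| <= spectrum_dist R G H.
Proof.
move=> sf; apply: ub_le_sup; last by exists f.
exists (#|G|%:R + #|H|%:R) => _ [g [sg ->]].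
apply: le_trans (ler_normB _ _) _; rewrite !ger0_norm; try exact: sp_ge0.
by apply: lerD; exact: sp_le_card.
Qed.

Lemma spectrum_dist_le G H (e : R) : 0 <= e ->
  (forall f : sgraph -> R, spectral_point f -> `|f G - f H| <= e) ->
  spectrum_dist R G H <= e.
Proof.
move=> e0 He; rewrite /spectrum_dist.
set D := [set x | _]; have [->|/set0P ne] := eqVneq D set0.
  (* The supremum of the empty set is 0 by convention, which is where [0 <= e] enters. *)
  by rewrite sup0.
by apply: ge_sup => // _ [f [sf ->]]; exact: He.
Qed.

End SpectrumDistance.

(** * Cauchy sequences and approximate geometricity *)

Section CauchyGeometric.
Variables (R : realType) (G : nat -> sgraph).
Hypothesis hG : forall n, nonempty_graph (G n).

Let fG1 (f : sgraph -> R) (sf : spectral_point f) n : 1 <= f (G n).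
Proof. exact: sp_ge1. Qed.

Let fG0 (f : sgraph -> R) (sf : spectral_point f) n : 0 <= f (G n).
Proof. exact: sp_ge0. Qed.

(** Both graphs carry the exponent [n] of the earlier one, so that multiplying over [n_1, ..., n_t]
    with [m] their sum assembles [f(G_m)^m]. *)
Definition log_gap (n c : nat) : Prop :=
  forall m (f : sgraph -> R), (n <= m)%N -> spectral_point f ->
    f (G n) ^+ n <= 2 ^+ c * f (G m) ^+ n /\ f (G m) ^+ n <= 2 ^+ c * f (G n) ^+ n.

Lemma cauchy_bounded : spectrum_cauchy R G ->
  exists b : nat, forall n (f : sgraph -> R), spectral_point f -> f (G n) <= 2 ^+ b.
Proof.
(* The successor leaves room for the 1 by which [f (G n)] may exceed [f (G N)] beyond [N]. *)
move=> /(_ 1 ltr01)[N cN]; pose b := (\sum_(i < N.+1) #|G i|).+1; exists b => n f sf.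
have le2 : b%:R <= 2 ^+ b :> R by rewrite -natrX ler_nat ltnW// ltn_expl.
have lesum (i : 'I_N.+1) : f (G i) + 1 <= b%:R.
  rewrite -natr1 lerD2r; apply: le_trans (sp_le_card sf _) _.
  by rewrite ler_nat (bigD1 i)//= leq_addr.
apply: le_trans le2; have [nN|Nn] := ltnP n N.+1.
  by apply: le_trans (lesum (Ordinal nN)); rewrite lerDl.
apply: le_trans (lesum ord_max).
have := spectrum_dist_ub (G n) (G N) sf; have := cN n N (ltnW Nn) (leqnn N).
move=> h1 h2; have := le_lt_trans h2 h1; have := ler_norm (f (G n) - f (G N)); lra.
Qed.

(** Boundedness provides some exponent for each [n], hence a least one; the Cauchy condition makes
    the least ones small relative to [n]. *)
Lemma cauchy_log_gap : spectrum_cauchy R G ->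
  exists k : nat -> nat, sublinear R k /\ forall n, log_gap n (k n).
Proof.
move=> cG; have [b hb] := cauchy_bounded cG.
have ex n : exists c, `[< log_gap n c >].
  exists (b * n)%N; apply/asboolP.
  have bound i j (f : sgraph -> R) : spectral_point f -> f (G i) ^+ n <= 2 ^+ (b * n) * f (G j) ^+ n.
    move=> sf; rewrite -[X in X <= _]mulr1 exprM.
    apply: ler_pM => //; rewrite ?exprn_ge0 ?(fG0 sf)//; last by rewrite exprn_ege1// (fG1 sf).
    by apply: lerXn2r; rewrite ?nnegrE ?(fG0 sf) ?exprn_ge0 ?hb.
  by move=> m f _ sf; split; exact: bound.
exists (fun n => ex_minn (ex n)); split=> [|n]; last by case: ex_minnP => k /asboolP.
apply/sublinearP => -[|q]; first by exists 0%N.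
have ln2 : 0 < ln 2 :> R by rewrite ln_gt0// ltr1n.
(* Chosen so that [exp(e n)] is 2 to the power [n / (2(q + 1))]. Rounding this exponent up costs at
   most 1, which [n >= 2(q + 1)] absorbs. *)
pose e : R := ln 2 / (2 * q.+1)%:R.
have e0 : 0 < e by rewrite divr_gt0// ltr0n.
have [N cN] := cG e e0; exists (N + 2 * q.+1)%N => n Nn.
have mono m m' (f : sgraph -> R) : (N <= m)%N -> (N <= m')%N -> spectral_point f ->
    f (G m) ^+ n <= 2 ^+ (n %/ (2 * q.+1)).+1 * f (G m') ^+ n.
  move=> Nm Nm' sf.
  have /lt_le_trans/(_ (expR_ge1Dx _)) dist : 1 + `|f (G m) - f (G m')| < 1 + e.
    by rewrite ltrD2l; apply: le_lt_trans (spectrum_dist_ub _ _ sf) (cN _ _ Nm Nm').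
  (* As [f (G m') >= 1], the additive distance [e] becomes a factor [1 + e <= exp(e)]. *)
  have le1 : f (G m) <= expR e * f (G m').
    have := ler_norm (f (G m) - f (G m')); have := fG1 sf m'.
    have := normr_ge0 (f (G m) - f (G m')); move: dist.
    move: (expR e) => E; nra.
  have : f (G m) ^+ n <= (expR e * f (G m')) ^+ n.
    by apply: lerXn2r; rewrite ?nnegrE ?mulr_ge0 ?expR_ge0 ?(fG0 sf).
  move=> /le_trans; apply; rewrite exprMn ler_wpM2r ?exprn_ge0 ?(fG0 sf)//.
  rewrite -expRM_natl -[2 in X in _ <= X](@lnK R) ?posrE ?ltr0n//.
  rewrite -expRM_natl ler_expR /e mulrCA mulrA [X in _ <= X]mulrC -mulrA ler_pM2l//.
  rewrite ler_pdivrMr ?ltr0n// -natrM ler_nat ltnW//.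
  exact: ltn_ceil.
case: ex_minnP => k _ /(_ (n %/ (2 * q.+1)).+1) mink.
have {mink} : (k <= (n %/ (2 * q.+1)).+1)%N.
  by apply: mink; apply/asboolP => m f nm sf; split; apply: mono => //; lia.
have := leq_divM n (2 * q.+1); move: (n %/ _)%N => d; nia.
Qed.

Lemma cauchy_approx_geometric : spectrum_cauchy R G ->
  approx_geometric R (asymp_le R) (fun n => strong_pow (G n) n).
Proof.
move=> /cauchy_log_gap[k [kl gap]]; exists k; split=> // t n _.
set M := (\sum_(i < t) n i)%N.
have nM i : (n i <= M)%N by rewrite /M (bigD1 i)//= leq_addr.
have nonbig : nonempty_graph (\big[strong_prod/edgeless 1]_(i < t) strong_pow (G (n i)) (n i)).
  apply: (big_ind nonempty_graph); first exact: nonempty_edgeless.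
    exact: nonempty_prod.
  by move=> i _; exact: nonempty_pow.
have pow2 c : nonempty_graph (strong_pow (edgeless 2) c).
  exact/nonempty_pow/nonempty_edgeless.
(* As [M] is the sum of the [n i], the power splits over [i], and each factor is an instance of
   [log_gap]. *)
have prodX (f : sgraph -> R) :
    2 ^+ (\sum_(i < t) k (n i)) * f (G M) ^+ M =
    \prod_(i < t) (2 ^+ k (n i) * f (G M) ^+ n i).
  by rewrite big_split /= !prodrXr.
split; apply: asymp_duality.
- exact/nonempty_prod/nonempty_pow.
- move=> f sf; rewrite (sp_big sf) (spM sf) !(sp_pow sf) (sp_edgeless sf) prodX.
  apply: ler_prod => i _; rewrite (sp_pow sf) exprn_ge0 ?(fG0 sf)//=.
  by have [] := gap (n i) M f (nM i) sf.
- exact: nonempty_prod.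
- move=> f sf; rewrite (spM sf) (sp_big sf) !(sp_pow sf) (sp_edgeless sf).
  rewrite -!prodrXr -big_split /=.
  apply: ler_prod => i _; rewrite (sp_pow sf) exprn_ge0 ?(fG0 sf)//=.
  by have [] := gap (n i) M f (nM i) sf.
Qed.

(** Taking [m] copies of [n] compares [f(G_n)^(mn)] with [f(G_(mn))^(mn)] at the cost [2^(m k_n)];
    as [q m k_n <= m n], this cost is at most 2 for [q]-th powers. *)
Lemma geometric_root (k : nat -> nat) (f : sgraph -> R) q n m :
  (forall (t : nat) (n : 'I_t -> nat), (0 < t)%N ->
    asymp_le R (\big[strong_prod/edgeless 1]_(i < t) strong_pow (G (n i)) (n i))
      (strong_prod (strong_pow (edgeless 2) (\sum_(i < t) k (n i))%N)
         (strong_pow (G (\sum_(i < t) n i)%N) (\sum_(i < t) n i)%N)) /\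
    asymp_le R (strong_pow (G (\sum_(i < t) n i)%N) (\sum_(i < t) n i)%N)
      (strong_prod (strong_pow (edgeless 2) (\sum_(i < t) k (n i))%N)
         (\big[strong_prod/edgeless 1]_(i < t) strong_pow (G (n i)) (n i)))) ->
  spectral_point f -> (0 < n)%N -> (0 < m)%N -> (q * k n <= n)%N ->
  f (G n) ^+ q <= 2 * f (G (m * n)%N) ^+ q /\ f (G (m * n)%N) ^+ q <= 2 * f (G n) ^+ q.
Proof.
move=> geo sf n0 m0 qk.
have := geo m (fun=> n) m0; rewrite !sum_nat_const card_ord.
have pow2 c : nonempty_graph (strong_pow (edgeless 2) c).
  exact/nonempty_pow/nonempty_edgeless.
have nonbig : nonempty_graph (\big[strong_prod/edgeless 1]_(i < m) strong_pow (G n) n).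
  apply: (big_ind nonempty_graph); first exact: nonempty_edgeless.
    exact: nonempty_prod.
  by move=> i _; exact: nonempty_pow.
have mqk : (q * (m * k n) <= m * n)%N by rewrite mulnCA leq_mul2l qk orbT.
have mn0 : (0 < m * n)%N by rewrite muln_gt0 m0.
move=> [/(sp_asymp_le sf (nonempty_prod (pow2 _) (nonempty_pow _ (hG _)))) h1
        /(sp_asymp_le sf (nonempty_prod (pow2 _) nonbig)) h2].
move: h1 h2; rewrite !(spM sf) !(sp_big sf) !(sp_pow sf) (sp_edgeless sf).
rewrite prodr_const card_ord -exprM [(n * m)%N]mulnC.
by move=> h1 h2; split; apply: (root_of_pow _ _ mn0 mqk) => //; exact: fG0.
Qed.

Lemma approx_geometric_cauchy :
  approx_geometric R (asymp_le R) (fun n => strong_pow (G n) n) -> spectrum_cauchy R G.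
Proof.
move=> [k [/sublinearP kl geo]].
(* The constant is [4 = 2 * 2] because [G n] and [G m] are each compared with [G (m * n)]. *)
have root q : exists N, forall n m (f : sgraph -> R), (N <= n)%N -> (N <= m)%N ->
    spectral_point f -> f (G n) ^+ q <= 4 * f (G m) ^+ q.
  have [N kN] := kl q; exists N.+1 => n m f Nn Nm sf.
  have n0 : (0 < n)%N by apply: leq_trans Nn.
  have m0 : (0 < m)%N by apply: leq_trans Nm.
  have [h1 _] := geometric_root geo sf n0 m0 (kN _ (ltnW Nn)).
  have [_] := geometric_root geo sf m0 n0 (kN _ (ltnW Nm)).
  rewrite mulnC; lra.
(* The case [q = 1] bounds all later values [f (G j)] by [B], uniformly in [f]. *)
have [N1 bound] := root 1%N; pose B : R := 4 * #|G N1|%:R.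
move=> e e0.
(* By [root_gap] with [c = 4], [q] times the difference of two values is at most [3 B], which this
   choice keeps below [q * (e / 2)]. *)
have [q qe] : exists q : nat, 6 * B / e < q%:R.
  by exists (Num.truncn (6 * B / e)).+1; exact: truncnS_gt.
have B0 : 0 <= B by rewrite mulr_ge0.
have q0 : 0 < q%:R :> R by apply: le_lt_trans qe; rewrite divr_ge0 ?(ltW e0)// mulr_ge0.
have [N rootq] := root q; exists (maxn N N1) => m n.
rewrite !geq_max => /andP[Nm N1m] /andP[Nn N1n].
(* A supremum inherits only a weak inequality; halving [e] restores the strict one. *)
apply: (@le_lt_trans _ _ (e / 2)); last by lra.
apply: spectrum_dist_le => [|f sf]; first by lra.
have gap i j : (N <= i)%N -> (N <= j)%N -> (N1 <= j)%N -> f (G i) - f (G j) <= e / 2.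
  move=> Ni Nj N1j; have := rootq i j f Ni Nj sf.
  move=> /(root_gap (fG0 sf i) (lt_le_trans ltr01 (fG1 sf j))) h.
  have := bound j N1 f N1j (leqnn _) sf; rewrite !expr1 => fB.
  have {}fB : f (G j) <= B by have := sp_le_card sf (G N1); rewrite /B; lra.
  rewrite -(ler_pM2l q0); move: qe; rewrite ltr_pdivrMr//; lra.
by rewrite ler_norml lerNl opprB !gap.
Qed.

End CauchyGeometric.

Theorem proposition5p30 (R : realType) (G : nat -> sgraph)
    (hG : forall n, nonempty_graph (G n)) :
  spectrum_cauchy R G <->
  approx_geometric R (asymp_le R) (fun n => strong_pow (G n) n).
Proof.
split; [exact: cauchy_approx_geometric | exact: approx_geometric_cauchy].
Qed.
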